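(* Let $p$ and $q$ be primes. If $R$ is a non-commutative ring with unity and $|R|=p^2q$, then $\Gamma_R$ is MSN-integral but not MSN-hyperenergetic.
   Context: For a ring $R$, $Z(R)$ is its center. For a finite non-commutative ring $R$, the commuting graph $\Gamma_R$ is the simple graph with vertex set $R\setminus Z(R)$ in which two distinct vertices are adjacent if they commute. Let $\Gamma$ be a finite simple graph with vertices $v_1,\dots,v_n$. Let $N(v_i)$ be the set of vertices adjacent to $v_i$, let $N^2(v_i)=\big(\bigcup_{u\in N(v_i)}N(u)\big)\setminus\{v_i\}$, and let $\delta_2(v_i)=\sum_{x\in N^2(v_i)}\deg x$. The minimum second neighborhood degree matrix $\mathrm{snm}(\Gamma)$ is the $n\times n$ matrix whose $(i,j)$ entry is $\min\{\delta_2(v_i),\delta_2(v_j)\}$ if $i\neq j$ and $v_i,v_j$ are adjacent, and $0$ otherwise. The MSN-energy $E_{\mathrm{sn}}(\Gamma)$ is the sum of the absolute values of the eigenvalues of $\mathrm{snm}(\Gamma)$, counted with multiplicity. $\Gamma$ is MSN-integral if all eigenvalues of $\mathrm{snm}(\Gamma)$ are integers, and MSN-hyperenergetic if $E_{\mathrm{sn}}(\Gamma)>E_{\mathrm{sn}}(K_n)$, where $K_n$ is the complete graph on $n=|V(\Gamma)|$ vertices. *)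

(* Defs.v *)
From mathcomp Require Import all_boot all_order all_algebra all_field.

Set Implicit Arguments.
Unset Strict Implicit.
Unset Printing Implicit Defensive.

Import Order.TTheory GRing.Theory Num.Theory.
Local Open Scope ring_scope.

Record sgraph := SGraph {
  vertex :> finType;
  adj : rel vertex;
  adj_sym : symmetric adj;
  adj_irrefl : irreflexive adj
}.
Arguments adj {_} _ _.

Section MSN.
Variable G : sgraph.
Implicit Types v : G.

Definition nbhd v : {set G} := [set u | adj v u].

Definition degree v : nat := #|nbhd v|.

Definition nbhd2 v : {set G} := (\bigcup_(u in nbhd v) nbhd u) :\ v.

Definition delta2 v : nat := (\sum_(x in nbhd2 v) degree x)%N.

(* The vertices are numbered by [enum_val].  The entries are taken in [algC]
   so that the eigenvalues exist; they are real since the matrix is real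
   symmetric. *)
Definition snm : 'M[algC]_#|G| :=
  \matrix_(i, j)
    let vi := enum_val i in let vj := enum_val j in
    if (i != j) && adj vi vj then (minn (delta2 vi) (delta2 vj))%:R else 0.

End MSN.

(* The eigenvalues of [A], each repeated according to its multiplicity as a
   root of the characteristic polynomial; see [char_poly_spectrum]. *)
Definition spectrum n (A : 'M[algC]_n) : seq algC :=
  sval (closed_field_poly_normal (char_poly A)).

Lemma char_poly_spectrum n (A : 'M[algC]_n) :
  char_poly A = \prod_(z <- spectrum A) ('X - z%:P).
Proof.
rewrite /spectrum; case: closed_field_poly_normal => r /= {1}->.
by rewrite (monicP (char_poly_monic A)) scale1r.
Qed.

Lemma mem_spectrum n (A : 'M[algC]_n) z : (z \in spectrum A) = eigenvalue A z.
Proof. by rewrite eigenvalue_root_char char_poly_spectrum root_prod_XsubC. Qed.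

Definition msn_energy (G : sgraph) : algC := \sum_(z <- spectrum (snm G)) `|z|.

Definition msn_integral (G : sgraph) : Prop :=
  forall z : algC, eigenvalue (snm G) z -> z \is a Num.int.

Section CompleteGraph.
Variable n : nat.

Definition complete_adj : rel 'I_n := fun i j => i != j.

Fact complete_adj_sym : symmetric complete_adj.
Proof. by move=> i j; rewrite /complete_adj eq_sym. Qed.

Fact complete_adj_irrefl : irreflexive complete_adj.
Proof. by move=> i; rewrite /complete_adj eqxx. Qed.

Definition complete_graph : sgraph :=
  SGraph complete_adj_sym complete_adj_irrefl.

End CompleteGraph.

Definition msn_hyperenergetic (G : sgraph) : Prop :=
  msn_energy (complete_graph #|G|) < msn_energy G.

Section CommutingGraph.
Variable R : finNzRingType.

Definition ring_center : {set R} := [set x | [forall y, x * y == y * x]].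

Definition noncentral : finType := {x : R | x \notin ring_center}.

Definition commuting_adj : rel noncentral :=
  fun x y => (x != y) && (val x * val y == val y * val x).

Fact commuting_adj_sym : symmetric commuting_adj.
Proof. by move=> x y; rewrite /commuting_adj eq_sym [_ * _ == _]eq_sym. Qed.

Fact commuting_adj_irrefl : irreflexive commuting_adj.
Proof. by move=> x; rewrite /commuting_adj eqxx. Qed.

Definition commuting_graph : sgraph :=
  SGraph commuting_adj_sym commuting_adj_irrefl.

End CommutingGraph.

(* Main.v *)
Require Import Defs.
From mathcomp Require Import all_boot all_order all_algebra all_field.
From mathcomp Require Import all_fingroup all_solvable ring.

(* Additively R is a group, and every prime dividing |R| is the additive order
   of some element, hence divides the additive order of 1 and so |Z(R)|.
   Applied to q this gives |R : Z(R)| dividing p^2; since a proper centralizer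
   lies strictly between Z(R) and R, the index is exactly p^2 and every
   noncentral element has a centralizer of order p |Z(R)|.  Two such
   centralizers meet in Z(R) or coincide, so the commuting graph is a disjoint
   union of cliques of the same size k + 1.  There [snm] is d times the
   adjacency matrix for a constant d, with only the eigenvalues -d and d k; the trace
   being 0, the energy is 2 n d k / (k + 1), which is largest for a single
   clique. *)

Set Implicit Arguments.
Unset Strict Implicit.
Unset Printing Implicit Defensive.

Import Order.TTheory GRing.Theory Num.Theory FinRing.Theory.
Local Open Scope ring_scope.

(** * Size and sum of the spectrum *)

Lemma size_spectrum n (A : 'M[algC]_n) : size (spectrum A) = n.
Proof.
by have := size_char_poly A; rewrite char_poly_spectrum size_prod_XsubC => -[].
Qed.

(** The trace is minus the subleading coefficient of the characteristic polynomial; size 0, where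
    there is none, is treated apart. *)
Lemma sum_spectrum n (A : 'M[algC]_n) : \sum_(z <- spectrum A) z = \tr A.
Proof.
have sz := size_spectrum A; case: n A sz => [|n] A sz.
  by rewrite (size0nil sz) big_nil /mxtrace big_ord0.
apply: oppr_inj; rewrite -char_poly_trace // char_poly_spectrum.
have := @coefPn_prod_XsubC _ (spectrum A); rewrite sz => ->//.
Qed.

(** * Spectrum and energy of a union of equal cliques *)

(* [k] is the degree: the cliques have [k.+1] vertices. *)
Definition union_of_cliques k (G : sgraph) : Prop :=
  (forall x y z : G, adj x y -> adj y z -> x != z -> adj x z) /\
  (forall x : G, degree x = k).

(* The cut-off is there because second neighbourhoods in K_2 are empty. *)
Definition clique_delta2 k : nat := (k ^ 2 * (1 < k))%N.

(** For [k > 1], each neighbour of [v] is also reached through a third vertex of the clique, so the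
    second neighbourhood is the neighbourhood: [k] vertices of degree [k]. For [k <= 1] it is
    empty. *)
Lemma union_of_cliques_delta2 k (G : sgraph) (v : G) :
  union_of_cliques k G -> delta2 v = clique_delta2 k.
Proof.
move=> [tr deg]; have nb2 (u x : G) : x \in nbhd2 u -> adj u x /\ (1 < k)%N.
  rewrite !inE => /andP[xu /bigcupP[w]]; rewrite !inE => uw wx.
  split; first by apply: tr uw wx _; rewrite eq_sym.
  (* The distinct neighbours [u] and [x] of [w] force [k > 1]. *)
  rewrite -(deg w) (leq_trans (_ : _ < #|[set u; x]|)%N) //.
    by rewrite cards2 eq_sym xu.
  apply/subset_leq_card/subsetP=> y; rewrite !inE => /orP[]/eqP->//.
  by rewrite adj_sym.
rewrite /delta2 (eq_bigr (fun=> k)) => [|x _]; last exact: deg.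
rewrite sum_nat_const /clique_delta2.
have [k1|k1] := boolP (1 < k)%N; last first.
  rewrite muln0 (_ : nbhd2 v = set0) ?cards0 //.
  by apply/setP=> x; rewrite in_set0; apply/negP=> /nb2[_]; apply/negP.
rewrite muln1 expnS expn1 -{2}(deg v) /degree; congr (#|pred_of_set _| * _)%N.
apply/setP=> x; apply/idP/idP=> [/nb2[vx _]|]; rewrite !inE // => vx.
have xv : x != v by apply: contraTneq vx => ->; rewrite adj_irrefl.
rewrite xv; have : (0 < #|nbhd v :\ x|)%N.
  have := cardsD1 x (nbhd v); rewrite inE vx -/(degree v) deg => E.
  by move: k1; rewrite E.
case/card_gt0P=> w; rewrite !inE => /andP[wx vw].
apply/bigcupP; exists w; rewrite inE //.
by apply: (tr w v x) => //; rewrite adj_sym.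
Qed.

(** [B] is [clique_delta2 k] times the 0-1 matrix of the equivalence relation of being equal or
    adjacent, and its classes have [k.+1] elements. *)
Lemma snm_sqr k (G : sgraph) (B := snm G + (clique_delta2 k)%:R%:M) :
  union_of_cliques k G -> B *m B = (clique_delta2 k * k.+1)%:R *: B.
Proof.
move=> Gk; have [tr deg] := Gk; set d := clique_delta2 k in B *.
pose e (x y : G) := (x == y) || adj x y.
have es x y : e x y = e y x by rewrite /e eq_sym adj_sym.
have et x y z : e x y -> e y z -> e x z.
  rewrite /e => /orP[/eqP->//|xy] /orP[/eqP<-|yz]; first by rewrite xy orbT.
  by have [//|xz] := eqVneq x z; exact: tr xy yz xz.
have ec x : #|[set y | e x y]| = k.+1.
  rewrite (cardsD1 x) inE /e eqxx -(deg x) /degree.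
  congr (_ + #|pred_of_set _|)%N.
  apply/setP=> y; rewrite !inE eq_sym; case: eqP => //= ->.
  by rewrite adj_irrefl.
have BE i j : B i j = (d * e (enum_val i) (enum_val j))%:R.
  rewrite !mxE /e (inj_eq enum_val_inj) !(union_of_cliques_delta2 _ Gk) minnn.
  case: (i == j); rewrite ?add0r ?addr0 ?muln1 //=.
  by case: adj; rewrite ?muln1 ?muln0.
apply/matrixP=> i j; rewrite [RHS]mxE mxE BE -natrM.
rewrite (eq_bigr _ (fun l _ => congr2 *%R (BE i l) (BE l j))).
rewrite -(big_enum_val (A := G) (fun y =>
  (d * e (enum_val i) y)%:R * (d * e y (enum_val j))%:R)) /=.
under eq_bigr => y _ do rewrite -natrM.
rewrite -natr_sum; congr _%:R; move: (enum_val i) (enum_val j) => x z.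
have [xz|xz] := boolP (e x z).
  rewrite (bigID (e x)) /= [X in (_ + X)%N]big1 => [|y /negPf->]; last first.
    by rewrite muln0.
  rewrite (eq_bigr (fun=> (d * d)%N)) => [|y xy]; last first.
    by rewrite xy (et y x z) ?muln1 // es.
  by rewrite sum_nat_const -(ec x) cardsE; ring.
rewrite !muln0 big1 // => y _; have [xy|_] := boolP (e x y);
  last by rewrite muln0.
suff /negPf->: ~~ e y z by rewrite !muln0.
by apply: contra xz; apply: et.
Qed.

(** By [snm_sqr], the matrix shifted by [d] has only the eigenvalues 0 and [d * k.+1]. *)
Lemma snm_eigenvalue k (G : sgraph) z : union_of_cliques k G ->
  eigenvalue (snm G) z ->
  z = - (clique_delta2 k)%:R \/ z = (clique_delta2 k * k)%:R.
Proof.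
move=> /snm_sqr; set d := clique_delta2 k; set B := _ + _ => BB.
case/eigenvalueP=> v vA v0.
have vB : v *m B = (z + d%:R) *: v by rewrite mulmxDr vA mul_mx_scalar scalerDl.
have : (z + d%:R) * (z + d%:R - (d * k.+1)%:R) == 0.
  have : ((z + d%:R) * (z + d%:R - (d * k.+1)%:R)) *: v == 0.
    have vBB : (v *m B) *m B = (d * k.+1)%:R *: (v *m B).
      by rewrite -mulmxA BB scalemxAr.
    move: vBB; rewrite vB -scalemxAl vB !scalerA => vBB.
    by rewrite mulrBr scalerBl vBB mulrC subrr.
  by rewrite scaler_eq0 (negbTE v0) orbF.
rewrite mulf_eq0 addr_eq0 => /orP[/eqP->|]; first by left.
rewrite mulnS natrD opprD addrA addrK subr_eq0 => /eqP->; by right.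
Qed.

Lemma union_of_cliques_msn_integral k (G : sgraph) :
  union_of_cliques k G -> msn_integral G.
Proof. by move=> Gk z /(snm_eigenvalue Gk)[]->; rewrite ?rpredN rpred_nat. Qed.

(* On the two possible eigenvalues [- d] and [d * k], the absolute value agrees
   with an affine function, so that the energy is determined by the trace. *)
Lemma union_of_cliques_energy k (G : sgraph) : union_of_cliques k G ->
  msn_energy G * k.+1%:R = (2 * #|G| * clique_delta2 k * k)%:R.
Proof.
move=> Gk; set d := clique_delta2 k.
(* The line through the values at [- d] and [d * k], scaled by [k.+1] to avoid a division. *)
have absE z : z \in spectrum (snm G) ->
    `|z| * k.+1%:R = (k%:R - 1) * z + (2 * d * k)%:R.
  rewrite mem_spectrum => /(snm_eigenvalue Gk)[]->; rewrite -/d.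
    by rewrite normrN normr_nat !natrM -natr1; ring.
  by rewrite normr_nat !natrM -natr1; ring.
rewrite /msn_energy mulr_suml big_seq (eq_bigr _ absE) -big_seq big_split /=.
rewrite -mulr_sumr sum_spectrum [\tr _]big1 => [|i _]; last first.
  by rewrite mxE eqxx.
rewrite mulr0 add0r big_const_seq count_predT size_spectrum iter_addr_0.
by rewrite -mulrnA; congr _%:R; ring.
Qed.

(** * Comparison with the complete graph *)

Lemma complete_graph_clique n : union_of_cliques n (complete_graph n.+1).
Proof.
split=> [//|x]; rewrite /degree (_ : nbhd x = [set~ x]) ?cardsC1 ?card_ord //.
by apply/setP=> y; rewrite !inE eq_sym.
Qed.

Lemma msn_energy_ge0 (G : sgraph) : 0 <= msn_energy G.
Proof. by apply: sumr_ge0. Qed.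

(** For a fixed number of vertices the energy grows with [k], and the complete graph has the largest
    possible degree. *)
Lemma union_of_cliques_not_hyperenergetic k (G : sgraph) :
  union_of_cliques k G -> ~ msn_hyperenergetic G.
Proof.
move=> Gk; rewrite /msn_hyperenergetic; apply/negP.
have EG := union_of_cliques_energy Gk.
suff: msn_energy G <= msn_energy (complete_graph #|G|) by move/le_gtF->.
case En: #|G| => [|n].
  have /eqP : msn_energy G * k.+1%:R = 0 by rewrite EG En muln0 !mul0n.
  by rewrite mulf_eq0 pnatr_eq0 orbF => /eqP->; exact: msn_energy_ge0.
have kn : (k <= n)%N.
  have /card_gt0P[v _] : (0 < #|G|)%N by rewrite En.
  rewrite -(Gk.2 v) -ltnS -En (cardD1 v) inE ltnS.
  apply/subset_leq_card/subsetP=> x; rewrite !inE andbT.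
  by apply: contraTneq => ->; rewrite adj_irrefl.
have := union_of_cliques_energy (complete_graph_clique n).
rewrite [#|_|]card_ord => EK.
(* Multiplying by [k.+1] and [n.+1] turns the claim into an inequality of naturals. *)
rewrite -(ler_pM2r (ltr0Sn _ k)) -(ler_pM2r (ltr0Sn _ n)) EG.
rewrite [leRHS]mulrAC EK -!natrM ler_nat En.
have dd : (clique_delta2 k <= clique_delta2 n)%N.
  rewrite /clique_delta2 leq_mul ?leq_exp2r //; case: (ltnP 1 k) => // k1.
  by rewrite (leq_trans k1 kn).
have : (k * n.+1 <= n * k.+1)%N by rewrite !mulnS leq_add // mulnC.
move=> /(leq_mul dd) /(leq_mul (leqnn (2 * n.+1)%N)).
by rewrite !mulnA.
Qed.

(** * Center and centralizers as additive groups *)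

Section CommutingGraph.
Variable R : finNzRingType.
Implicit Types x y : R.

Definition centralizer x : {set R} := [set y | x * y == y * x].

Lemma centralizer_group_set x : group_set (centralizer x).
Proof.
apply/group_setP; split=> [|a b]; rewrite !inE.
  by rewrite zmod1gE mulr0 mul0r.
by move=> /eqP xa /eqP xb; rewrite zmodMgE mulrDr mulrDl xa xb.
Qed.
Canonical centralizer_group x := Group (centralizer_group_set x).

Lemma ring_center_group_set : group_set (ring_center R).
Proof.
apply/group_setP; split=> [|a b]; rewrite !inE.
  by apply/forallP=> y; rewrite zmod1gE mulr0 mul0r.
move=> /forallP Ha /forallP Hb; apply/forallP=> y.
by rewrite zmodMgE mulrDr mulrDl (eqP (Ha y)) (eqP (Hb y)).
Qed.
Canonical ring_center_group := Group ring_center_group_set.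

Lemma center_sub_centralizer x : ring_center R \subset centralizer x.
Proof.
by apply/subsetP=> z; rewrite !inE => /forallP/(_ x); rewrite eq_sym.
Qed.

Lemma mem_centralizer x : x \in centralizer x.
Proof. by rewrite inE. Qed.

Lemma prime_dvd_card_center r :
  prime r -> (r %| #|R|)%N -> (r %| #|ring_center R|)%N.
Proof.
move=> r_pr; rewrite -cardsT => /(Cauchy (G := [set: R]%G) r_pr)[x _ <-].
(* With [m] the order of the center, [x *+ m = x * (1 *+ m)], and [1 *+ m = 0] by Lagrange. *)
rewrite order_dvdn zmodXgE zmod1gE -[x]mulr1 -mulrnAr.
have /(order_dvdG (G := ring_center_group)) : 1 \in ring_center_group.
  by rewrite inE; apply/forallP=> y; rewrite mulr1 mul1r.
by rewrite order_dvdn zmodXgE => /eqP->; rewrite mulr0.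
Qed.

Lemma center_proper_centralizer x :
  x \notin ring_center R -> ring_center R \proper centralizer x.
Proof.
move=> xZ; rewrite properE center_sub_centralizer.
by apply: contra xZ => /subsetP; apply; exact: mem_centralizer.
Qed.

Lemma centralizer_proper x :
  x \notin ring_center R -> centralizer x \proper [set: R].
Proof.
rewrite properE subsetT; apply: contra => /subsetP xR.
by rewrite inE; apply/forallP=> y; have := xR y (in_setT _); rewrite inE.
Qed.

Lemma card_ring_center_gt0 : (0 < #|ring_center R|)%N.
Proof. exact: cardG_gt0 ring_center_group. Qed.

(** Lagrange along two proper inclusions: center, centralizer, ring. *)
Lemma centralizer_index c x :
    #|R| = (c * #|ring_center R|)%N -> x \notin ring_center R ->
  exists i, [/\ (1 < i < c)%N, (i %| c)%N
               & #|centralizer x| = (i * #|ring_center R|)%N].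
Proof.
move=> cR xZ; have Z0 := card_ring_center_gt0.
have /dvdnP[i iE] : (#|ring_center R| %| #|centralizer x|)%N.
  exact: cardSg (center_sub_centralizer x).
have : (#|centralizer x| %| #|[set: R]|)%N by apply: cardSg (subsetT _).
have := proper_card (center_proper_centralizer xZ).
have := proper_card (centralizer_proper xZ).
rewrite cardsT cR iE ltn_pmul2r // dvdn_pmul2r // => i_c.
rewrite -{1}[#|_|]mul1n ltn_pmul2r // => i_gt i_dv.
by exists i; split=> //; rewrite i_gt.
Qed.

(** * Center of index a prime square *)

Section CenterIndex.
Variable r : nat.
Hypotheses (r_pr : prime r) (indexZ : #|R| = (r ^ 2 * #|ring_center R|)%N).

Lemma card_centralizer x :
  x \notin ring_center R -> #|centralizer x| = (r * #|ring_center R|)%N.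
Proof.
move=> /(centralizer_index indexZ)[i [/andP[i_gt i_lt] i_dv ->]].
case/(dvdn_pfactor _ _ r_pr): i_dv i_gt i_lt => -[|[|[|j]]] // _ -> //.
by rewrite ltnn.
Qed.

(** The intersection of the two centralizers contains the noncentral [y], so its index over the
    center is a divisor of [r] other than 1, and it fills [centralizer x]. *)
Lemma centralizer_sub x y :
  x \notin ring_center R -> y \notin ring_center R -> x * y = y * x ->
  centralizer x \subset centralizer y.
Proof.
move=> xZ yZ xy; have Z0 := card_ring_center_gt0.
pose I := (centralizer_group x :&: centralizer_group y)%G.
have ZI : ring_center R \subset I by rewrite subsetI !center_sub_centralizer.
have /dvdnP[i iE] : (#|ring_center R| %| #|I|)%N by exact: cardSg ZI.
have Zlt : (#|ring_center R| < #|I|)%N.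
  apply: proper_card; rewrite properE ZI; apply: contra yZ => /subsetP; apply.
  by rewrite !inE xy !eqxx.
have : (#|I| %| #|centralizer x|)%N by apply: cardSg (subsetIl _ _).
rewrite iE card_centralizer // dvdn_pmul2r // => i_dv.
move: Zlt; rewrite iE -{1}[#|ring_center R|]mul1n ltn_pmul2r // => i_gt.
have ir : i = r.
  by apply/eqP; move/primeP: r_pr => [_ /(_ _ i_dv)]; rewrite gtn_eqF.
apply/setIidPl/eqP; rewrite eqEcard subsetIl card_centralizer //.
by move: (leqnn #|I|); rewrite {1}iE ir.
Qed.

Lemma commuting_graph_cliques :
  union_of_cliques (r * #|ring_center R| - #|ring_center R|).-1
    (commuting_graph R).
Proof.
split=> [x y z|x].
  case/andP=> _ /eqP xy /andP[_ /eqP yz] xz; apply/andP; split=> //.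
  have /subsetP/(_ (val z)) := centralizer_sub (valP y) (valP x) (esym xy).
  by rewrite !inE yz eqxx => ->.
rewrite /degree -(card_imset _ val_inj) -(card_centralizer (valP x)).
(* The vertex [x] is not its own neighbour, hence the predecessor in the degree. *)
rewrite (_ : val @: _ = (centralizer (val x) :\: ring_center R) :\ val x).
  have := cardsD1 (val x) (centralizer (val x) :\: ring_center R).
  rewrite inE (valP x) mem_centralizer cardsD (setIidPr _).
    by move=> ->.
  exact: center_sub_centralizer.
apply/setP=> y; apply/imsetP/idP => [[u]|].
  rewrite inE => /andP[xu cxu] ->; rewrite in_setD1 in_setD (valP u) inE cxu.
  by rewrite (inj_eq val_inj) eq_sym xu.
rewrite in_setD1 in_setD => /and3P[yx yZ]; rewrite inE => xy.
exists (Sub y yZ); rewrite ?inE ?SubK // /adj /= /commuting_adj SubK xy.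
by rewrite -(inj_eq val_inj) SubK eq_sym yx.
Qed.

End CenterIndex.
End CommutingGraph.

(** * Rings of order [p ^ 2 * q] *)

Theorem theorem4p2 (p q : nat) (hp : prime p) (hq : prime q)
    (R : finNzRingType)
    (hnc : ~ (forall x y : R, (x * y = y * x)%R))
    (hcard : #|R| = (p ^ 2 * q)%N) :
  msn_integral (commuting_graph R) /\ ~ msn_hyperenergetic (commuting_graph R).
Proof.
have [x xZ] : exists x, x \notin ring_center R.
  apply/existsP; apply: contra_notT hnc; rewrite negb_exists => /forallP Zx x y.
  by have := Zx x; rewrite negbK inE => /forallP/(_ y)/eqP.
have /dvdnP[c cR] : (#|ring_center R| %| #|R|)%N.
  by rewrite -cardsT; apply: (cardSg (G := [set: R]%G)) (subsetT _).
have /dvdnP[t tZ] : (q %| #|ring_center R|)%N.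
  by rewrite prime_dvd_card_center // hcard dvdn_mull.
have : (c %| p ^ 2)%N.
  apply/dvdnP; exists t; apply/eqP; rewrite -(eqn_pmul2r (prime_gt0 hq)).
  by rewrite -hcard cR tZ mulnCA mulnA.
case/(dvdn_pfactor _ _ hp)=> e e2 cE.
(* An index 1 or [p] has no divisor strictly between 1 and itself, as a centralizer requires. *)
have e_2 : e = 2%N.
  have [i [/andP[i1 ic] idv _]] := centralizer_index cR xZ.
  case: e e2 cE => [|[|[|e]]] // _ cE; move: i1 ic idv; rewrite cE.
    by case: i => [|[]].
  rewrite expn1 => i1 ic i_dv; move/primeP: hp => [_ /(_ _ i_dv)].
  by rewrite gtn_eqF // ltn_eqF.
rewrite cE e_2 in cR; have Gk := commuting_graph_cliques hp cR.
by split; [exact: union_of_cliques_msn_integral Gk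
          | exact: union_of_cliques_not_hyperenergetic Gk].
Qed.
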